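(* A set $A \subset \mathbb{D}([0,1];\mathbb{D})$ is relatively compact with respect to $d_{\mathbb{D}}$ if and only if it satisfies the following three conditions: (i) $\sup_{x \in A}\|x\|_{\mathbb{D}}<\infty$; (ii) $\lim_{\delta \to 0}\sup_{x \in A} \sup_{t \in [0,1]}w'\big(x(t),\delta\big)=0$; (iii) $\lim_{\delta \to 0} \sup_{x \in A} w'_{\mathbb{D}}(x,\delta)=0$.
   Context: $\mathbb{D}$ is the set of functions $x:[0,1]\to\mathbb{R}$ that are right-continuous and have left limits, with $\|x\|=\sup_{s\in[0,1]}|x(s)|$. $\Lambda$ is the set of strictly increasing continuous functions from $[0,1]$ onto $[0,1]$, $e$ is the identity on $[0,1]$, and for $\lambda\in\Lambda$, $\|\lambda\|^0=\sup_{s<s'}\left|\log\frac{\lambda(s')-\lambda(s)}{s'-s}\right|$. The Skorohod $J_1$-topology on $\mathbb{D}$ is given by the (complete, separable) metric $d_{J_1}^0(x,y)=\inf_{\lambda\in\Lambda}\{\|\lambda\|^0\vee\|x-y\circ\lambda\|\}$. $\mathbb{D}([0,1];\mathbb{D})$ is the set of functions $x:[0,1]\to\mathbb{D}$ that are right-continuous at every $t\in[0,1)$ and have a left limit $x(t-)\in\mathbb{D}$ at every $t\in(0,1]$, both with respect to $d_{J_1}^0$. Put $\|x\|_{\mathbb{D}}=\sup_{t\in[0,1]}\|x(t)\|$. It is equipped with the metric $d_{\mathbb{D}}(x,y)=\inf_{\lambda\in\Lambda}\{\|\lambda-e\|\vee\rho_{\mathbb{D}}(x,y\circ\lambda)\}$,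 where $\rho_{\mathbb{D}}(x,y)=\sup_{t\in[0,1]}d_{J_1}^0(x(t),y(t))$. A set $\{t_i\}_{0\le i\le v}$ with $0=t_0<t_1<\dots<t_v=1$ is $\delta$-sparse if $\min_{1\le i\le v}(t_i-t_{i-1})>\delta$. For $\delta\in(0,1)$: for $x\in\mathbb{D}$, $w'(x,\delta)=\inf_{\{t_i\}}\max_{1\le i\le v}\ \sup_{s_1,s_2\in[t_{i-1},t_i)}|x(s_1)-x(s_2)|$; for $x\in\mathbb{D}([0,1];\mathbb{D})$, $w'_{\mathbb{D}}(x,\delta)=\inf_{\{t_i\}}\max_{1\le i\le v}\ \sup_{r_1,r_2\in[t_{i-1},t_i)}d_{J_1}^0(x(r_1),x(r_2))$; both infima being over all $\delta$-sparse sets. Relatively compact means having compact closure. *)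

(* Defs.v *)
From HB Require Import structures.
From mathcomp Require Import all_boot all_order all_algebra.
From mathcomp Require Import all_classical all_reals all_analysis.

Set Implicit Arguments.
Unset Strict Implicit.
Unset Printing Implicit Defensive.
Import Order.TTheory GRing.Theory Num.Theory.
Import numFieldNormedType.Exports.

Local Open Scope classical_set_scope.
Local Open Scope ring_scope.

(* [0,1] as a type, with the subtype topology of R. *)
Definition I01 (R : realType) : Type := set_type `[(0 : R), (1 : R)].

Section Cadlag.
Variables (R : realType) (T : topologicalType).

Record cadlag := Cadlag {
  cadlag_fun :> I01 R -> T ;
  cadlag_right : forall t : I01 R, \val t < 1 ->
    cadlag_fun s @[s --> within (fun s => \val t < \val s) (nbhs t)]
      --> cadlag_fun t ;
  cadlag_left : forall t : I01 R, 0 < \val t ->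
    exists l : T,
      cadlag_fun s @[s --> within (fun s => \val s < \val t) (nbhs t)] --> l
}.

End Cadlag.

Section TimeChange.
Variable R : realType.

Record timechange := TimeChange {
  timechange_fun :> I01 R -> I01 R ;
  timechange_incr : forall s t, \val s < \val t ->
    \val (timechange_fun s) < \val (timechange_fun t) ;
  timechange_cont : continuous timechange_fun ;
  timechange_surj : set_surj setT setT timechange_fun
}.

(* ||l||^0, possibly +oo *)
Definition lognorm (l : timechange) : \bar R :=
  ereal_sup [set `|ln ((\val (l p.2) - \val (l p.1)) /
                       (\val p.2 - \val p.1))|%:E |
             p in [set p : I01 R * I01 R | \val p.1 < \val p.2]].

(* ||l - e|| *)
Definition unifnorm (l : timechange) : \bar R :=
  ereal_sup (range (fun t => `|\val (l t) - \val t|%:E)).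

End TimeChange.

(* Distances take values in \bar R, so that suprema and infima need no side
   condition; on cadlag functions they are in fact finite. *)
Section SkorokhodDistance.
Variables (R : realType) (S : Type).
Implicit Types x y : I01 R -> S.

Definition sup_dist (d : S -> S -> \bar R) x y : \bar R :=
  ereal_sup (range (fun t => d (x t) (y t))).

Definition skorokhod_dist (cost : timechange R -> \bar R)
    (d : S -> S -> \bar R) x y : \bar R :=
  ereal_inf (range (fun l : timechange R =>
    maxe (cost l) (sup_dist d x (y \o l)))).

(* t_0 < ... < t_v is the delta-sparse set; t is irrelevant beyond v. *)
Definition sparse (delta : R) (v : nat) (t : nat -> R) : Prop :=
  [/\ t 0%N = 0, t v = 1,
      (forall i, (i < v)%N -> t i < t i.+1) &
      (forall i, (i < v)%N -> delta < t i.+1 - t i)].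

Definition oscillation (d : S -> S -> \bar R) x (a b : R) : \bar R :=
  ereal_sup [set d (x p.1) (x p.2) | p in
    [set p : I01 R * I01 R |
      (a <= \val p.1 < b) /\ (a <= \val p.2 < b)]].

Definition cadlag_modulus (d : S -> S -> \bar R) x (delta : R) : \bar R :=
  ereal_inf [set (\big[maxe/0%E]_(i < p.1)
                   oscillation d x (p.2 i) (p.2 i.+1)) |
             p in [set p : nat * (nat -> R) | sparse delta p.1 p.2]].

End SkorokhodDistance.

(* Time changes form a group for composition, under which both costs are
   symmetric and subadditive. *)
Section TimeChangeGroup.
Variable R : realType.
Implicit Types l m : timechange R.

Lemma incr_surj_continuous (f : I01 R -> I01 R) :
  (forall s t, \val s < \val t -> \val (f s) < \val (f t)) ->
  set_surj setT setT f -> continuous f.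
Proof.
move=> fincr fsurj.
have valc : continuous (\val : I01 R -> R) by exact: initial_continuous.
have val01 (s : I01 R) : 0 <= \val s <= 1.
  by have := set_valP s; rewrite /= in_itv.
have sur (r : R) : 0 <= r <= 1 -> exists a, \val (f a) = r.
  move=> r01.
  have r01' : r \in `[(0 : R), 1]%classic by apply/mem_set; rewrite /= in_itv.
  have [a _ fa] := fsurj (exist _ r r01' : I01 R) I.
  by exists a; rewrite fa.
suff vf : continuous (\val \o f : I01 R -> R).
  move=> t U [V [[W oW <-] /= Wt WU]].
  have : nbhs t ((\val \o f) @^-1` W) by apply: vf; exact: open_nbhs_nbhs.
  by apply: filterS => s /= Ws; exact: WU.
have incr_lt (s t : I01 R) : \val (f s) < \val (f t) -> \val s < \val t.
  move=> fst; rewrite ltNge; apply/negP; rewrite le_eqVlt => /orP[/eqP ts|ts].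
    by move: fst; rewrite (val_inj ts) ltxx.
  by move: (lt_trans fst (fincr _ _ ts)); rewrite ltxx.
move=> t; apply/(@cvgrPdist_lt _ R _ _ (nbhs_filter t)) => e e0.
have lo : \forall s \near t, \val (f t) - e < \val (f s).
  have [h|h] := ltP (\val (f t) - e) 0.
    by near=> s; apply: (lt_le_trans h); case/andP: (val01 (f s)).
  have [a fa] : exists a, \val (f a) = \val (f t) - e.
    apply: sur; rewrite h /=; have /andP[_] := val01 (f t).
    by apply: le_trans; rewrite gerBl ltW.
  have at_ : \val a < \val t by apply: incr_lt; rewrite fa gtrBl.
  have : \forall s \near t, \val a < (\val (s : I01 R)).
    by apply: (cvgr_gt _ (valc t)).
  by apply: filterS => s /fincr; rewrite fa.
have hi : \forall s \near t, \val (f s) < \val (f t) + e.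
  have [h|h] := ltP 1 (\val (f t) + e).
    by near=> s; apply: le_lt_trans h; case/andP: (val01 (f s)).
  have [a fa] : exists a, \val (f a) = \val (f t) + e.
    apply: sur; rewrite h andbT; have /andP[+ _] := val01 (f t).
    by move/le_trans; apply; rewrite lerDl ltW.
  have at_ : \val t < \val a by apply: incr_lt; rewrite fa ltrDl.
  have : \forall s \near t, (\val (s : I01 R)) < \val a.
    by apply: (cvgr_lt _ (valc t)).
  by apply: filterS => s /fincr; rewrite fa.
near=> s; rewrite /= ltr_distlC; apply/andP; split.
- by near: s.
- by near: s.
Unshelve. all: by end_near. Qed.

Lemma timechange_inj l : injective l.
Proof.
move=> s t lst; apply: val_inj.
have [st|st|//] := ltgtP (\val s) (\val t);
  by move: (timechange_incr l st); rewrite lst ltxx.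
Qed.

Lemma id_surj : set_surj setT setT (@id (I01 R)).
Proof. by move=> t _; exists t. Qed.

Definition idtc : timechange R :=
  @TimeChange R id (fun s t st => st) (fun t => @cvg_id _ (nbhs t)) id_surj.

Lemma comp_incr l m s t :
  \val s < \val t -> \val ((l \o m) s) < \val ((l \o m) t).
Proof. by move=> st; do 2!apply: timechange_incr. Qed.

Lemma comp_surj l m : set_surj setT setT (l \o m).
Proof.
move=> t _; have [u _ <-] := timechange_surj l (t := t) I.
by have [w _ <-] := timechange_surj m (t := u) I; exists w.
Qed.

Definition comptc l m : timechange R :=
  TimeChange (@comp_incr l m)
    (incr_surj_continuous (@comp_incr l m) (@comp_surj l m)) (@comp_surj l m).

Definition invf l t : I01 R := sval (cid2 (timechange_surj l (t := t) I)).

Lemma invfK l : cancel (invf l) l.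
Proof. by move=> t; rewrite /invf; case: cid2. Qed.

Lemma invKf l : cancel l (invf l).
Proof. by move=> t; apply: (@timechange_inj l); rewrite invfK. Qed.

Lemma invf_incr l s t : \val s < \val t -> \val (invf l s) < \val (invf l t).
Proof.
move=> st; rewrite ltNge; apply/negP; rewrite le_eqVlt => /orP[/eqP ts|ts].
  by move: st; rewrite -(invfK l s) -(val_inj ts) invfK ltxx.
move: (timechange_incr l ts); rewrite !invfK => ts'.
by move: (lt_trans st ts'); rewrite ltxx.
Qed.

Lemma invf_surj l : set_surj setT setT (invf l).
Proof. by move=> t _; exists (l t) => //; exact: invKf. Qed.

Definition invtc l : timechange R :=
  TimeChange (@invf_incr l)
    (incr_surj_continuous (@invf_incr l) (@invf_surj l)) (@invf_surj l).

Record admissible_cost (c : timechange R -> \bar R) : Prop := AdmissibleCost {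
  cost_id : c idtc = 0%E ;
  cost_inv : forall l, (c (invtc l) <= c l)%E ;
  cost_comp : forall l m, (c (comptc l m) <= c l + c m)%E
}.

Lemma lognorm_admissible : admissible_cost (@lognorm R).
Proof.
split.
- apply/eqP; rewrite eq_le; apply/andP; split.
    apply: ge_ereal_sup => _ [[s t] /= st <-].
    by rewrite divff ?ln1 ?normr0// subr_eq0 gt_eqF.
  have z0 : (0 : R) \in `[(0 : R), 1]%classic.
    by apply/mem_set; rewrite /= in_itv /= lexx ler01.
  have z1 : (1 : R) \in `[(0 : R), 1]%classic.
    by apply/mem_set; rewrite /= in_itv /= lexx ler01.
  apply: ereal_sup_ubound; exists (exist _ 0 z0, exist _ 1 z1) => /=.
    exact: ltr01.
  by rewrite divff ?ln1 ?normr0// subr0 oner_neq0.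
- move=> l; apply: ge_ereal_sup => _ [[s t] /= st <-].
  apply: ereal_sup_ubound; exists (invf l s, invf l t) => /=.
    exact: invf_incr.
  rewrite !invfK; congr EFin.
  by rewrite -[in RHS]invf_div lnV ?normrN// posrE divr_gt0 // subr_gt0 //;
    exact: invf_incr.
- move=> l m; apply: ge_ereal_sup => _ [[s t] /= st <-].
  have mst := timechange_incr m st.
  have lmst := timechange_incr l mst.
  have -> : (\val (l (m t)) - \val (l (m s))) / (\val t - \val s) =
     ((\val (l (m t)) - \val (l (m s))) / (\val (m t) - \val (m s))) *
     ((\val (m t) - \val (m s)) / (\val t - \val s)).
    by rewrite mulrA divfK // subr_eq0 gt_eqF.
  rewrite lnM ?posrE ?divr_gt0 ?subr_gt0//.
  apply: (@le_trans _ _ (`|ln ((\val (l (m t)) - \val (l (m s))) /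
      (\val (m t) - \val (m s)))|%:E +
     `|ln ((\val (m t) - \val (m s)) / (\val t - \val s))|%:E)%E).
    by rewrite -EFinD lee_fin ler_normD.
  by apply: leeD; apply: ereal_sup_ubound; [exists (m s, m t)|exists (s, t)].
Qed.

Lemma unifnorm_admissible : admissible_cost (@unifnorm R).
Proof.
split.
- apply/eqP; rewrite eq_le; apply/andP; split.
    by apply: ge_ereal_sup => _ [t _ <-] /=; rewrite subrr normr0.
  have z0 : (0 : R) \in `[(0 : R), 1]%classic.
    by apply/mem_set; rewrite /= in_itv /= lexx ler01.
  apply: ereal_sup_ubound; exists (exist _ 0 z0) => //=.
  by rewrite subrr normr0.
- move=> l; apply: ge_ereal_sup => _ [t _ <-] /=.
  by apply: ereal_sup_ubound; exists (invf l t) => //=; rewrite invfK distrC.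
- move=> l m; apply: ge_ereal_sup => _ [t _ <-] /=.
  apply: (@le_trans _ _ (`|\val (l (m t)) - \val (m t)|%:E +
                          `|\val (m t) - \val t|%:E)%E).
    by rewrite -EFinD lee_fin ler_distD.
  by apply: leeD; apply: ereal_sup_ubound; [exists (m t)|exists t].
Qed.

End TimeChangeGroup.

Section SkorokhodPseudometric.
Variables (R : realType) (S : Type).

Record ext_pseudometric (d : S -> S -> \bar R) : Prop := ExtPseudometric {
  edist_ge0 : forall x y, (0 <= d x y)%E ;
  edistxx : forall x, d x x = 0%E ;
  edist_sym : forall x y, d x y = d y x ;
  edist_triangle : forall x y z, (d x z <= d x y + d y z)%E
}.

End SkorokhodPseudometric.

Section SkorokhodPseudometricTheory.
Variables (R : realType) (S : Type).
Variables (c : timechange R -> \bar R) (d : S -> S -> \bar R).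
Hypotheses (cP : admissible_cost c) (dP : ext_pseudometric d).

Let o01 : I01 R.
Proof.
exists 0; apply/mem_set; rewrite /= in_itv /= lexx; exact: ler01.
Defined.

Lemma sup_dist_ge0 x y : (0 <= sup_dist d x y)%E.
Proof.
apply: (le_trans (edist_ge0 dP (x o01) (y o01))).
by apply: ereal_sup_ubound; exists o01.
Qed.

Lemma skorokhod_sym_le x y :
  (skorokhod_dist c d x y <= skorokhod_dist c d y x)%E.
Proof.
apply: le_ereal_inf_tmp => _ [l _ <-].
apply: (@le_trans _ _ (maxe (c (invtc l)) (sup_dist d x (y \o invtc l)))).
  by apply: ereal_inf_lbound; exists (invtc l).
rewrite ge_max; apply/andP; split.
  by rewrite le_max cost_inv.
rewrite le_max; apply/orP; right.
apply: ge_ereal_sup => _ [t _ <-] /=.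
apply: ereal_sup_ubound; exists (invf l t) => //=.
by rewrite invfK (edist_sym dP).
Qed.

Lemma skorokhod_ext_pseudometric : ext_pseudometric (skorokhod_dist c d).
Proof.
have ge0 x y : (0 <= skorokhod_dist c d x y)%E.
  apply: le_ereal_inf_tmp => _ [l _ <-].
  by rewrite le_max sup_dist_ge0 orbT.
split => //.
- move=> x; apply/eqP; rewrite eq_le ge0 andbT.
  apply: ereal_inf_lbound; exists (idtc R) => //.
  rewrite (cost_id cP).
  suff -> : sup_dist d x (x \o idtc R) = 0%E by rewrite maxxx.
  apply/eqP; rewrite eq_le sup_dist_ge0 andbT.
  by apply: ge_ereal_sup => _ [t _ <-] /=; rewrite edistxx.
- by move=> x y; apply/eqP; rewrite eq_le !skorokhod_sym_le.
move=> x y z.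
have [->|xy] := eqVneq (skorokhod_dist c d x y) +oo%E.
  by rewrite addye ?leey// gt_eqF// (lt_le_trans _ (ge0 y z)) ?ltNy0.
have [->|yz] := eqVneq (skorokhod_dist c d y z) +oo%E.
  by rewrite addey ?leey// gt_eqF// (lt_le_trans _ (ge0 x y)) ?ltNy0.
have xyf : skorokhod_dist c d x y \is a fin_num by rewrite ge0_fin_numE ?ltey.
have yzf : skorokhod_dist c d y z \is a fin_num by rewrite ge0_fin_numE ?ltey.
apply/lee_addgt0Pr => e e0.
have e20 : (0 < e / 2)%R by rewrite divr_gt0.
have [_ [l _ <-] hl] := lb_ereal_inf_adherent e20 xyf.
have [_ [m _ <-] hm] := lb_ereal_inf_adherent e20 yzf.
apply: (@le_trans _ _ (maxe (c (comptc m l))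
                           (sup_dist d x (z \o comptc m l)))).
  by apply: ereal_inf_lbound; exists (comptc m l).
have -> : (skorokhod_dist c d x y + skorokhod_dist c d y z + e%:E =
  (skorokhod_dist c d x y + (e / 2)%:E) +
  (skorokhod_dist c d y z + (e / 2)%:E))%E.
  by rewrite addeACA -EFinD -splitr.
move: hl hm; rewrite !gt_max => /andP[cl xl] /andP[cm ym].
rewrite ge_max; apply/andP; split.
  apply: le_trans (cost_comp cP m l) _; rewrite addeC.
  by apply: leeD; exact: ltW.
apply: ge_ereal_sup => _ [t _ <-] /=.
apply: le_trans (edist_triangle dP _ (y (l t)) _) _.
apply: leeD.
- apply: le_trans (ltW xl); apply: ereal_sup_ubound; by exists t.
- apply: le_trans (ltW ym); apply: ereal_sup_ubound; by exists (l t).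
Qed.

End SkorokhodPseudometricTheory.

Lemma absdist_ext_pseudometric (R : realType) :
  @ext_pseudometric R R (fun a b => `|a - b|%:E).
Proof.
split=> [a b|a|a b|a b c].
- by rewrite lee_fin.
- by rewrite subrr normr0.
- by rewrite distrC.
- by rewrite -EFinD lee_fin ler_distD.
Qed.

(* Both dJ1 and dDD are genuine metrics; the topology only needs the
   pseudometric axioms, so separation is not proved here. *)
Section BallOfDistance.
Variables (R : realType) (S : Type) (d : S -> S -> \bar R).
Hypothesis dP : ext_pseudometric d.

Definition ball_of (x : S) (e : R) : set S := [set y | (d x y < e%:E)%E].

Lemma ball_of_center x (e : R) : 0 < e -> ball_of x e x.
Proof. by rewrite /ball_of /= (edistxx dP) lte_fin. Qed.

Lemma ball_of_sym x y (e : R) : ball_of x e y -> ball_of y e x.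
Proof. by rewrite /ball_of /= (edist_sym dP). Qed.

Lemma ball_of_triangle x y z (e1 e2 : R) :
  ball_of x e1 y -> ball_of y e2 z -> ball_of x (e1 + e2) z.
Proof.
rewrite /ball_of /= => xy yz.
by apply: le_lt_trans (edist_triangle dP x y z) _; rewrite EFinD lteD.
Qed.

End BallOfDistance.

(* The space D of real cadlag functions, with the J_1 topology. *)
Definition skorD (R : realType) : Type := cadlag R R.

Definition dJ1 (R : realType) : skorD R -> skorD R -> \bar R :=
  skorokhod_dist (@lognorm R) (fun a b : R => `|a - b|%:E).

Lemma dJ1_ext_pseudometric (R : realType) : ext_pseudometric (@dJ1 R).
Proof.
have P := skorokhod_ext_pseudometric (@lognorm_admissible R)
  (@absdist_ext_pseudometric R).
split=> *; [exact: edist_ge0 P _ _|exact: edistxx P _|exact: edist_sym P _ _|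
  exact: edist_triangle P _ _ _].
Qed.

HB.instance Definition _ (R : realType) := gen_eqMixin (skorD R).
HB.instance Definition _ (R : realType) := gen_choiceMixin (skorD R).
HB.instance Definition _ (R : realType) :=
  hasNbhs.Build (skorD R) (nbhs_ (entourage_ (ball_of (@dJ1 R)))).
HB.instance Definition _ (R : realType) :=
  @Nbhs_isPseudoMetric.Build R (skorD R)
    (entourage_ (ball_of (@dJ1 R))) erefl
    (ball_of (@dJ1 R))
    (ball_of_center (@dJ1_ext_pseudometric R))
    (ball_of_sym (@dJ1_ext_pseudometric R))
    (ball_of_triangle (@dJ1_ext_pseudometric R)) erefl.

(* The space D([0,1]; D): cadlag with respect to the J_1 topology. *)
Definition skorDD (R : realType) : Type := cadlag R (skorD R).

Definition dDD (R : realType) : skorDD R -> skorDD R -> \bar R :=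
  skorokhod_dist (@unifnorm R) (@dJ1 R).

Lemma dDD_ext_pseudometric (R : realType) : ext_pseudometric (@dDD R).
Proof.
have P := skorokhod_ext_pseudometric (@unifnorm_admissible R)
  (@dJ1_ext_pseudometric R).
split=> *; [exact: edist_ge0 P _ _|exact: edistxx P _|exact: edist_sym P _ _|
  exact: edist_triangle P _ _ _].
Qed.

HB.instance Definition _ (R : realType) := gen_eqMixin (skorDD R).
HB.instance Definition _ (R : realType) := gen_choiceMixin (skorDD R).
HB.instance Definition _ (R : realType) :=
  hasNbhs.Build (skorDD R) (nbhs_ (entourage_ (ball_of (@dDD R)))).
HB.instance Definition _ (R : realType) :=
  @Nbhs_isPseudoMetric.Build R (skorDD R)
    (entourage_ (ball_of (@dDD R))) erefl
    (ball_of (@dDD R))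
    (ball_of_center (@dDD_ext_pseudometric R))
    (ball_of_sym (@dDD_ext_pseudometric R))
    (ball_of_triangle (@dDD_ext_pseudometric R)) erefl.

(* ||x||_D = sup_t ||x(t)|| *)
Definition normDD (R : realType) (x : skorDD R) : \bar R :=
  ereal_sup (range (fun t => ereal_sup (range (fun s => `|x t s|%:E)))).

Definition w' (R : realType) (x : skorD R) (delta : R) : \bar R :=
  cadlag_modulus (fun a b : R => `|a - b|%:E) x delta.

Definition wDD' (R : realType) (x : skorDD R) (delta : R) : \bar R :=
  cadlag_modulus (@dJ1 R) x delta.

(* Supremum of f over A in [0, +oo], so that it is 0 (not -oo) for empty A. *)
Definition sup_over (R : realType) (T : Type) (A : set T) (f : T -> \bar R) :
  \bar R := ereal_sup (0%E |` f @` A).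

(* Main.v *)
Require Import Defs.
From HB Require Import structures.
From mathcomp Require Import all_boot all_order all_algebra.
From mathcomp Require Import all_classical all_reals all_analysis.
From mathcomp Require Import ring lra.
Import Order.TTheory GRing.Theory Num.Theory.
Import numFieldNormedType.Exports.
Local Open Scope classical_set_scope.
Local Open Scope ring_scope.

(** Both levels of the statement, real paths and paths of real paths, are cadlag
    paths in a pseudometric space S with a Skorokhod distance; only the cost of
    time changes differs.  The arguments are made once, for arbitrary S, and
    applied twice.

    Sufficiency.  Suppose the paths of A take values in a compact set Q and have
    uniformly small modulus.  Compactness of closure A follows once every
    ultrafilter F containing A converges (ultra_compact_closure).  For each e,
    every path of A has a partition with gaps bounded below and oscillation below
    e on the cells.  Along F the number of cells is eventually constant, and the
    knots, lying in [0, 1], and the values there, lying in Q, converge; since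
    the gaps are bounded below, limit knots remain distinct (ultra_skeleton).
    So F is eventually close to a step function, for every e.  Rather than
    completing a Cauchy sequence of step functions, which would require infinite
    compositions of time changes, the limit path is read off the pointwise
    limits of F, taken slightly to the right of each time
    (ultra_skorokhod_cvg).  The time changes needed are piecewise linear with
    slopes near 1, so they are cheap for the logarithmic norm, and then also
    for the uniform norm (unifnorm_lognorm).  With S the real line, (i) and (ii)
    show that the set of all values x(t), for x in A and t in [0, 1], is
    relatively compact (skorD_compact); its closure serves as Q for S the space
    of real paths, where the modulus condition is (iii) (skorDD_compact).

    Necessity.  Each condition says that some property P(delta, x)
    holds for all x in A when delta is small.  Such a property is
    uniform on a compact set as soon as it is locally uniform: valid near each
    point for all small delta (locally_uniform_compact).  Bounds by 1/delta are
    locally uniform on the real line; the moduli are locally uniform because a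
    good partition for x is carried by a time change to a good partition for a
    nearby path (modulus_locally_uniform).  Finally, a locally uniform property
    of points of S yields one of paths in S, namely its validity at all values
    of the path, as the range and the left limits of a cadlag
    path together form a compact set
    (range_locally_uniform).  This lifts boundedness twice and the inner modulus
    once. *)

Set Implicit Arguments.
Unset Strict Implicit.
Unset Printing Implicit Defensive.

(** * The unit interval as a space of times *)

Section UnitInterval.
Variable R : realType.
Implicit Types (s t : I01 R) (r : R).

Lemma I01_bounds t : 0 <= \val t <= 1.
Proof. by have := set_valP t; rewrite /= in_itv. Qed.

Lemma clip_subproof r : Num.max 0 (Num.min r 1) \in `[(0 : R), 1]%classic.
Proof.
apply/mem_set; rewrite /= in_itv /= le_max lexx /=.
by rewrite ge_max ler01 ge_min lexx orbT.
Qed.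

(** Knots of partitions are real numbers; this retraction turns them into
    arguments of paths without carrying membership proofs. *)
Definition clip r : I01 R :=
  exist _ (Num.max 0 (Num.min r 1)) (clip_subproof r).

Lemma clipE r : 0 <= r <= 1 -> \val (clip r) = r.
Proof. by case/andP=> r0 r1; rewrite /= (min_idPl r1) (max_idPr r0). Qed.

Lemma nbhs_I01P t (U : set (I01 R)) :
  nbhs t U <-> exists2 r : R, 0 < r & forall s, `|\val s - \val t| < r -> U s.
Proof.
split=> [[V [[W oW <-] /= Wt WU]]|[r r0 rU]].
  have : nbhs (\val t) W by exact: open_nbhs_nbhs.
  case/nbhs_ballP=> r r0 rW; exists r => // s st; apply: WU; apply: rW.
  by rewrite -ball_normE /= distrC.
have valc : continuous (\val : I01 R -> R) by exact: initial_continuous.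
have : nbhs t (\val @^-1` ball (\val t : R) r).
  by apply: valc; exact: nbhsx_ballx.
apply: filterS => s; rewrite -ball_normE /= distrC; exact: rU.
Qed.

Lemma right_nbhsP t (U : set (I01 R)) :
  within (fun s => \val t < \val s) (nbhs t) U <->
  exists2 r : R, 0 < r & forall s, \val t < \val s < \val t + r -> U s.
Proof.
rewrite /within; split=> [/nbhs_I01P[r r0 rU]|[r r0 rU]].
  exists r => // s /andP[ts st]; apply: rU => //.
  by rewrite gtr0_norm ?subr_gt0// ltrBlDl.
apply/nbhs_I01P; exists r => // s st ts; apply: rU.
by rewrite ts /= -ltrBlDl -(gtr0_norm (x := \val s - \val t)) ?subr_gt0.
Qed.

Lemma left_nbhsP t (U : set (I01 R)) :
  within (fun s => \val s < \val t) (nbhs t) U <->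
  exists2 r : R, 0 < r & forall s, \val t - r < \val s < \val t -> U s.
Proof.
rewrite /within; split=> [/nbhs_I01P[r r0 rU]|[r r0 rU]].
  exists r => // s /andP[ts st]; apply: rU => //.
  by rewrite distrC gtr0_norm ?subr_gt0// ltrBlDl -ltrBlDr.
apply/nbhs_I01P; exists r => // s st ts; apply: rU.
rewrite ts andbT ltrBlDr -ltrBlDl.
by rewrite -(gtr0_norm (x := \val t - \val s)) ?subr_gt0// distrC.
Qed.

Lemma right_nbhs_proper t : \val t < 1 ->
  ProperFilter (within (fun s => \val t < \val s) (nbhs t)).
Proof.
move=> t1; apply: Build_ProperFilter_ex => U /right_nbhsP[r r0 rU].
have /andP[t0 _] := I01_bounds t.
have [r1 r1P] : exists r1, r1 = Num.min (r / 2) (1 - \val t) by eexists.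
have r10 : 0 < r1 by rewrite r1P lt_min divr_gt0//= subr_gt0.
have r1r : r1 < r by rewrite r1P gt_min; apply/orP; left; lra.
have r11 : r1 <= 1 - \val t by rewrite r1P ge_min lexx orbT.
exists (clip (\val t + r1)); apply: rU; rewrite clipE; lra.
Qed.

Lemma left_nbhs_proper t : 0 < \val t ->
  ProperFilter (within (fun s => \val s < \val t) (nbhs t)).
Proof.
move=> t1; apply: Build_ProperFilter_ex => U /left_nbhsP[r r0 rU].
have /andP[_ t0] := I01_bounds t.
have [r1 r1P] : exists r1, r1 = Num.min (r / 2) (\val t) by eexists.
have r10 : 0 < r1 by rewrite r1P lt_min divr_gt0//=.
have r1r : r1 < r by rewrite r1P gt_min; apply/orP; left; lra.
have r11 : r1 <= \val t by rewrite r1P ge_min lexx orbT.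
exists (clip (\val t - r1)); apply: rU; rewrite clipE; lra.
Qed.

End UnitInterval.

(** * Time changes and the two costs *)

Section TimeChangeFacts.
Variable R : realType.
Implicit Types (l : timechange R) (s t : I01 R).

Lemma timechange_le l s t : \val s <= \val t -> \val (l s) <= \val (l t).
Proof.
rewrite le_eqVlt => /orP[/eqP/val_inj->//|st]; exact/ltW/timechange_incr.
Qed.

Lemma timechange_lt_inv l s t : \val (l s) < \val (l t) -> \val s < \val t.
Proof. by rewrite !ltNge; apply: contra => /timechange_le; apply. Qed.

Lemma timechange_le_inv l s t : \val (l s) <= \val (l t) -> \val s <= \val t.
Proof. by rewrite !leNgt; apply: contra => /timechange_incr; apply. Qed.

Lemma timechange0 l t : \val t = 0 -> \val (l t) = 0.
Proof.
move=> t0; have c0 : \val (clip (0 : R)) = 0 by rewrite clipE// lexx ler01.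
apply/le_anti; case/andP: (I01_bounds (l t)) => -> _; rewrite andbT.
rewrite -[leRHS]c0 -(Defs.invfK l (clip 0)); apply: timechange_le.
by rewrite t0; case/andP: (I01_bounds (Defs.invf l (clip 0))).
Qed.

Lemma timechange1 l t : \val t = 1 -> \val (l t) = 1.
Proof.
move=> t1; have c1 : \val (clip (1 : R)) = 1 by rewrite clipE// lexx ler01.
apply/le_anti; case/andP: (I01_bounds (l t)) => _ -> /=.
rewrite -[leLHS]c1 -(Defs.invfK l (clip 1)); apply: timechange_le.
by rewrite t1; case/andP: (I01_bounds (Defs.invf l (clip 1))).
Qed.

(** A time change fixes 0, so the displacement of t is t times the deviation
    from 1 of the slope of the chord over [0, t]. *)
Lemma unifnorm_lognorm l (k : R) : 0 <= k ->
  (lognorm l <= k%:E)%E -> (unifnorm l <= (expR k - 1)%:E)%E.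
Proof.
move=> k0 lk; apply: ge_ereal_sup => _ [t _ <-]; rewrite lee_fin.
have /andP[t0 t1] := I01_bounds t.
move: t0; rewrite le_eqVlt => /orP[/eqP t0|t0].
  rewrite (timechange0 l (esym t0)) -t0 subrr normr0.
  by rewrite subr_ge0 -expR0 ler_expR.
have [z z0] : exists z : I01 R, \val z = 0.
  by exists (clip 0); rewrite clipE// lexx ler01.
have l0 : \val (l z) = 0 by apply: timechange0.
have lt0 : 0 < \val (l t).
  by rewrite -[ltLHS]l0; apply: timechange_incr; rewrite z0.
have : (`|ln (\val (l t) / \val t)|%:E <= k%:E)%E.
  apply: le_trans lk; apply: ereal_sup_ubound; exists (z, t) => /=.
    by rewrite z0.
  by rewrite z0 l0 !subr0.
set q := _ / _; have q0 : 0 < q by rewrite divr_gt0.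
rewrite lee_fin ler_norml => /andP[q1 q2].
have lq : \val (l t) = q * \val t by rewrite divfK// gt_eqF.
have qk : q <= expR k by rewrite -[leLHS]lnK ?posrE// ler_expR.
have qk' : expR (- k) <= q by rewrite -[leRHS]lnK ?posrE// ler_expR.
have ek : 1 <= expR k by rewrite -expR0 ler_expR.
have ek1 : expR k * expR (- k) = 1 by exact: expRxMexpNx_1.
have ek0 := expR_gt0 (- k).
(* AM-GM makes the lower deviation 1 - expR (- k) at most expR k - 1 *)
have h : 2 <= expR k + expR (- k) by nra.
have : `|q - 1| <= expR k - 1 by rewrite ler_norml; lra.
move=> hq; rewrite lq -{2}(mul1r (\val t)) -mulrBl normrM (gtr0_norm t0).
have := normr_ge0 (q - 1); nra.
Qed.

End TimeChangeFacts.

Lemma lognorm_dominates (R : realType) (u : R) : 0 < u -> exists2 k, 0 < k &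
  forall l : timechange R, (lognorm l <= k%:E)%E -> (unifnorm l <= u%:E)%E.
Proof.
move=> u0; have k0 : 0 < ln (1 + u) by rewrite ln_gt0// ltrDl.
exists (ln (1 + u)) => // l lk.
apply: le_trans (unifnorm_lognorm (ltW k0) lk) _.
by rewrite lnK ?posrE ?addr_gt0// addrC addKr.
Qed.

(** * Partitions and piecewise linear time changes *)

Lemma knots_le (R : realType) (t : nat -> R) v :
  (forall i, (i < v)%N -> t i < t i.+1) ->
  forall i j, (i <= j <= v)%N -> t i <= t j.
Proof.
move=> ti i; elim=> [|j IHj]; first by rewrite leqn0 => /andP[/eqP->].
case/andP; rewrite leq_eqVlt => /orP[/eqP->//|ij jv].
apply: le_trans (ltW (ti j jv)); apply: IHj.
by rewrite -ltnS ij ltnW.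
Qed.

Lemma knots01 (R : realType) (t : nat -> R) v : t 0%N = 0 -> t v = 1 ->
  (forall i, (i < v)%N -> t i < t i.+1) ->
  forall i, (i <= v)%N -> 0 <= t i <= 1.
Proof.
move=> t0 tv ti i iv; apply/andP; split.
  by rewrite -[leLHS]t0; apply: (knots_le ti).
by rewrite -[leRHS]tv; apply: (knots_le ti); rewrite iv leqnn.
Qed.

Lemma right_cell (R : realType) (T : nat -> R) v s : T 0%N <= s < T v ->
  exists2 i, (i < v)%N & T i <= s < T i.+1.
Proof.
elim: v => [|v IHv] /andP[s0 sv].
  by move: (le_lt_trans s0 sv); rewrite ltxx.
have [svv|vs] := ltP s (T v).
  have [|i iv si] := IHv; first by rewrite s0.
  by exists i => //; exact: ltnW.
by exists v => //; rewrite vs.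
Qed.

Lemma left_cell (R : realType) (T : nat -> R) v s : T 0%N < s <= T v ->
  exists2 i, (i < v)%N & T i < s <= T i.+1.
Proof.
elim: v => [|v IHv] /andP[s0 sv].
  by move: (lt_le_trans s0 sv); rewrite ltxx.
have [svv|vs] := leP s (T v).
  have [|i iv si] := IHv; first by rewrite s0.
  by exists i => //; exact: ltnW.
by exists v => //; rewrite vs.
Qed.

Section PiecewiseLinear.
Variables (R : realType) (v : nat) (t t' : nat -> R).
Hypotheses (t0 : t 0%N = 0) (tv : t v = 1) (t'0 : t' 0%N = 0) (t'v : t' v = 1).
Hypothesis ti : forall i, (i < v)%N -> t i < t i.+1.

Let slope i := (t' i.+1 - t' i) / (t i.+1 - t i).
Let piece i (s : R) := Num.min s (t i.+1) - Num.min s (t i).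

(** The piecewise linear map sending t i to t' i, written as a sum over the
    cells of slope times length covered: bounds on its increments are then
    termwise, and no case analysis on the cell of s occurs. *)
Definition interpolant (s : R) : R :=
  \sum_(0 <= i < v) slope i * piece i s.

Let piece_incr i s s' : (i < v)%N -> s <= s' -> piece i s <= piece i s'.
Proof.
move=> /ti ht ss; rewrite /piece /Num.min.
by do 4!case: ifPn => ?; lra.
Qed.

Let sum_piece s : 0 <= s <= 1 -> \sum_(0 <= i < v) piece i s = s.
Proof.
move=> /andP[s0 s1]; rewrite /piece.
rewrite (telescope_sumr (fun i => Num.min s (t i)) (leq0n v)) t0 tv.
by rewrite (min_idPl s1) (min_idPr s0) subr0.
Qed.

Lemma interpolant_knot j : (j <= v)%N -> interpolant (t j) = t' j.
Proof.
move=> jv; rewrite /interpolant.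
rewrite (eq_big_nat _ _ (F2 := fun i => t' (minn i.+1 j) - t' (minn i j))).
  (* at t j the i-th term is the image of the part of cell i left of t j *)
  rewrite (telescope_sumr (fun i => t' (minn i j)) (leq0n v)).
  by rewrite (minn_idPr jv) min0n t'0 subr0.
move=> i /andP[_ iv]; rewrite /piece; case: (leqP i.+1 j) => ij.
  rewrite (minn_idPl (ltnW ij)).
  have h1 : t i.+1 <= t j by apply: (knots_le ti); rewrite ij.
  have h2 : t i <= t j by apply: (knots_le ti); rewrite ltnW.
  rewrite (min_idPr h1) (min_idPr h2) /slope divfK// subr_eq0 gt_eqF//; exact: ti.
have h1 : t j <= t i.+1 by apply: (knots_le ti); rewrite ltnW.
have h2 : t j <= t i by apply: (knots_le ti); rewrite -ltnS ij ltnW.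
by rewrite (min_idPl h1) (min_idPl h2) (minn_idPr _)// !subrr mulr0.
Qed.

Variable k : R.
Hypothesis slopes : forall i, (i < v)%N -> expR (- k) <= slope i <= expR k.

Let interpolant_incr s s' : 0 <= s <= 1 -> 0 <= s' <= 1 -> s <= s' ->
  expR (- k) * (s' - s) <= interpolant s' - interpolant s <= expR k * (s' - s).
Proof.
move=> s01 s'01 ss; have -> : s' - s = \sum_(0 <= i < v) (piece i s' - piece i s).
  by rewrite sumrB !sum_piece.
rewrite /interpolant -sumrB !mulr_sumr; apply/andP; split.
  apply: ler_sum_nat => i /andP[_ iv]; rewrite -mulrBr.
  apply: ler_wpM2r; first by rewrite subr_ge0 piece_incr.
  by case/andP: (slopes iv).
apply: ler_sum_nat => i /andP[_ iv]; rewrite -mulrBr.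
apply: ler_wpM2r; first by rewrite subr_ge0 piece_incr.
by case/andP: (slopes iv).
Qed.

Let interpolant_cont : continuous interpolant.
Proof.
move=> s; apply: cvg_big; first exact: add_continuous.
move=> i _; apply: cvgM; first exact: cvg_cst.
by apply: cvgB; (apply: (@continuous_min R R); [exact: cvg_id|exact: cvg_cst]).
Qed.

Let interpolant0 : interpolant 0 = 0.
Proof. by have := interpolant_knot (leq0n v); rewrite t0 t'0. Qed.

Let interpolant1 : interpolant 1 = 1.
Proof. by have := interpolant_knot (leqnn v); rewrite tv t'v. Qed.

Let interpolant01 s : 0 <= s <= 1 -> 0 <= interpolant s <= 1.
Proof.
move=> /[dup] s01 /andP[s0 s1].
have z01 : (0 : R) <= (0 : R) <= 1 by rewrite lexx ler01.
have o01 : (0 : R) <= (1 : R) <= 1 by rewrite lexx ler01.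
have /andP[h1 _] := interpolant_incr z01 s01 s0.
have /andP[h2 _] := interpolant_incr s01 o01 s1.
move: h1 h2; rewrite interpolant0 interpolant1 subr0 => h1 h2.
have e0 := expR_gt0 (- k).
by apply/andP; split; nra.
Qed.

(** The logarithmic norm only sees slopes of chords, and every chord slope is
    an average of the slopes of the cells. *)
Lemma piecewise_timechange : exists l : timechange R,
  (lognorm l <= k%:E)%E /\
  forall i s, (i <= v)%N -> \val s = t i -> \val (l s) = t' i.
Proof.
have [f fE] : exists f : I01 R -> I01 R,
    forall s, \val (f s) = interpolant (\val s).
  exists (fun s => clip (interpolant (\val s))) => s.
  by rewrite clipE// interpolant01// I01_bounds.
have fincr s u : \val s < \val u -> \val (f s) < \val (f u).
  move=> su; rewrite !fE -subr_gt0.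
  have /andP[h _] := interpolant_incr (I01_bounds s) (I01_bounds u) (ltW su).
  by apply: lt_le_trans h; rewrite mulr_gt0 ?expR_gt0// subr_gt0.
have fsurj : set_surj setT setT f.
  move=> u _; have /andP[u0 u1] := I01_bounds u.
  have [||c] := @IVT R interpolant 0 1 (\val u) ler01.
  - exact: continuous_subspaceT.
  - by rewrite interpolant0 interpolant1 (min_idPl ler01) (max_idPr ler01) u0.
  rewrite in_itv /= => c01 cu; exists (clip c) => //.
  by apply: val_inj; rewrite fE clipE.
exists (TimeChange fincr (incr_surj_continuous fincr fsurj) fsurj); split.
  apply: ge_ereal_sup => _ [[s u] /= su <-]; rewrite lee_fin !fE.
  have su0 : 0 < \val u - \val s by rewrite subr_gt0.
  have /andP[h1 h2] := interpolant_incr (I01_bounds s) (I01_bounds u) (ltW su).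
  have q1 : expR (- k) <=
      (interpolant (\val u) - interpolant (\val s)) / (\val u - \val s).
    by rewrite ler_pdivlMr.
  have q2 : (interpolant (\val u) - interpolant (\val s)) /
      (\val u - \val s) <= expR k.
    by rewrite ler_pdivrMr.
  have q0 := lt_le_trans (expR_gt0 (- k)) q1.
  rewrite ler_norml; apply/andP; split.
    by rewrite -ler_expR lnK ?posrE.
  by rewrite -ler_expR lnK ?posrE.
by move=> i s iv si; rewrite /= fE si interpolant_knot.
Qed.

End PiecewiseLinear.

(** * Compactness by ultrafilters *)

Lemma ultra_fmap (T U : Type) (f : T -> U) (F : set_system T) :
  UltraFilter F -> UltraFilter (f @ F).
Proof.
move=> FU; split=> [|G GF FG]; first exact: fmap_proper_filter.
rewrite eqEsubset; split=> // B GB.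
have [//|FB] := in_ultra_setVsetC (f @^-1` B) FU.
have /(filterI GB) : G (~` B) by apply: FG.
by rewrite setICr => /filter_not_empty.
Qed.

(** Every ultrafilter on closure K is shadowed by one on K, generated by the
    traces on K of the neighbourhoods of its members, and limits of the shadow
    are limits of the original. *)
Lemma ultra_compact_closure (R : realType) (S : pseudoMetricType R)
    (K : set S) :
  (forall F : set_system S, UltraFilter F -> F K -> exists x : S, F --> x) ->
  compact (closure K).
Proof.
move=> Kcvg; rewrite compact_ultra => G GU GK.
pose B (p : set S * R) := [set a | K a /\ exists2 y, p.1 y & ball y p.2 a].
pose D := [set p : set S * R | G p.1 /\ 0 < p.2].
have HF : Filter (filter_from D B).
  apply: filter_from_filter.
    by exists (setT, 1); split => //=; exact: filterT.
  move=> [g1 e1] [g2 e2] [/= Gg1 e10] [/= Gg2 e20].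
  exists (g1 `&` g2, Num.min e1 e2).
    by split; [exact: filterI|rewrite /= lt_min e10].
  move=> a [/= Ka [y [g1y g2y] ya]]; split; split => //; exists y => //=.
    by apply: le_ball ya; rewrite ge_min lexx.
  by apply: le_ball ya; rewrite ge_min lexx orbT.
have HP : ProperFilter (filter_from D B).
  apply: filter_from_proper => -[g e] [/= Gg e0].
  have [y [gy Ky]] := filter_ex (filterI Gg GK).
  have [a [Ka ya]] := Ky _ (nbhsx_ballx y e e0).
  by exists a; split => //; exists y.
have [H [HU subH]] := ultraFilterLemma HP.
have HK : H K.
  apply: subH; exists (setT, 1); first by split => //=; exact: filterT.
  by move=> a [].
have [x Hx] := Kcvg H HU HK.
have Gx : G --> x.
  apply/fcvg_ballP => e e0.
  have e20 : 0 < e / 2 by rewrite divr_gt0.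
  have [//|GC] := in_ultra_setVsetC (ball x e) GU.
  have H1 : H (B (~` ball x e, e / 2)).
    by apply: subH; exists (~` ball x e, e / 2).
  have H2 : H (ball x (e / 2)) by apply: Hx; exact: nbhsx_ballx.
  have [a [[_ [y /= ny ya]] xa]] := filter_ex (filterI H1 H2).
  by case: ny; exact: ball_splitl xa ya.
exists x; split => //.
apply: (@closed_closure _ K); move=> V Vx.
have [y []] := filter_ex (filterI GK (Gx _ Vx)); by exists y.
Qed.

Lemma filter_forall_lt (T : Type) (F : set_system T) (P : nat -> T -> Prop) v :
  Filter F -> (forall i, (i < v)%N -> F (P i)) ->
  F [set y | forall i, (i < v)%N -> P i y].
Proof.
move=> FF; elim: v => [|v IHv] FP; first by apply: filterS filterT => y _.
have F1 := IHv (fun i iv => FP i (ltnW iv)).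
apply: filterS (filterI F1 (FP v (ltnSn v))) => y [/= Py Pv] i.
by rewrite ltnS leq_eqVlt => /orP[/eqP->//|]; exact: Py.
Qed.

Lemma ultra_bounded_nat (T : Type) (F : set_system T) (V : T -> nat) N :
  UltraFilter F -> F [set y | (V y <= N)%N] -> exists v, F [set y | V y = v].
Proof.
move=> FU; elim: N => [|N IHN] FN.
  by exists 0%N; apply: filterS FN => y /=; rewrite leqn0 => /eqP.
have [FN1|FN1] := in_ultra_setVsetC [set y | V y = N.+1] FU.
  by exists N.+1.
apply: IHN; apply: filterS (filterI FN FN1) => y [/=].
by rewrite leq_eqVlt => /orP[/eqP yN nyN|].
Qed.

(** * Moduli and distances in terms of balls *)

Section Balls.
Variables (R : realType) (S : pseudoMetricType R) (d : S -> S -> \bar R).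
Implicit Types (x y : I01 R -> S).

(** Oscillation at most e, stated pair by pair: balls replace suprema of
    extended reals from here on. *)
Definition osc_ball x (e a b : R) := forall s1 s2 : I01 R,
  a <= \val s1 < b -> a <= \val s2 < b -> ball (x s1) e (x s2).

Hypothesis dball : forall p q e, ball p e q <-> (d p q < e%:E)%E.

(** These lemmas trade the infima defining the modulus and the
    distance for an explicit partition and an explicit time change. *)
Lemma modulus_lt x delta (e : R) : (cadlag_modulus d x delta < e%:E)%E ->
  exists v T, sparse delta v T /\
    forall i, (i < v)%N -> osc_ball x e (T i) (T i.+1).
Proof.
case/ereal_inf_lt => _ [[v T] /= vT <-] osc.
exists v, T; split => // i iv s1 s2 s1i s2i; apply/dball.
apply: le_lt_trans osc.
apply: le_trans (le_bigmax _ _ (Ordinal iv)).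
by apply: ereal_sup_ubound; exists (s1, s2).
Qed.

Lemma modulus_le x delta (e : R) v T : 0 <= e -> sparse delta v T ->
  (forall i, (i < v)%N -> osc_ball x e (T i) (T i.+1)) ->
  (cadlag_modulus d x delta <= e%:E)%E.
Proof.
move=> e0 vT osc.
apply: (@le_trans _ _ (\big[maxe/0%E]_(i < v) oscillation d x (T i) (T i.+1))).
  by apply: ereal_inf_lbound; exists (v, T).
apply: bigmax_le => // i _; apply: ge_ereal_sup => _ [[s1 s2] /= [s1i s2i] <-].
by apply/ltW/dball; exact: (osc i (ltn_ord i)).
Qed.

Lemma modulus_mono x (delta delta' : R) : delta <= delta' ->
  (cadlag_modulus d x delta <= cadlag_modulus d x delta')%E.
Proof.
move=> dd; apply: ereal_inf_le_tmp => _ [[v T] /= [T0 Tv Ti Td] <-].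
exists (v, T) => //; split => // i iv.
by apply: le_lt_trans dd _; exact: Td.
Qed.

Lemma skor_lt (c : timechange R -> \bar R) x y (e : R) :
  (skorokhod_dist c d x y < e%:E)%E -> exists l : timechange R,
    (c l < e%:E)%E /\ forall t, ball (x t) e (y (l t)).
Proof.
case/ereal_inf_lt => _ [l _ <-]; rewrite gt_max => /andP[cl xy].
exists l; split => // t; apply/dball; apply: le_lt_trans xy.
by apply: ereal_sup_ubound; exists t.
Qed.

Lemma skor_le (c : timechange R -> \bar R) x y (e : R) (l : timechange R) :
  (c l <= e%:E)%E -> (forall t, ball (x t) e (y (l t))) ->
  (skorokhod_dist c d x y <= e%:E)%E.
Proof.
move=> cl xy; apply: (@le_trans _ _ (maxe (c l) (sup_dist d x (y \o l)))).
  by apply: ereal_inf_lbound; exists l.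
rewrite ge_max cl /=; apply: ge_ereal_sup => _ [t _ <-].
by apply/ltW/dball; exact: xy.
Qed.

End Balls.

(** * Convergence of ultrafilters of cadlag paths *)

Section UltraLimit.
Variables (R : realType) (S : pseudoMetricType R) (Q : set S).
Hypothesis Qc : compact Q.

(** Right continuity needs no completeness.  For a left limit the values form
    a Cauchy filter, and compactness of Q supplies its limit. *)
Lemma regulated_cadlag (x : I01 R -> S) : (forall s, Q (x s)) ->
  (forall e, 0 < e -> exists v T, [/\ T 0%N = 0, T v = 1 &
     forall i, (i < v)%N -> osc_ball x e (T i) (T i.+1)]) ->
  exists y : cadlag R S, y =1 x.
Proof.
move=> Qx osc.
suff [xr xl] : (forall t : I01 R, \val t < 1 ->
    x s @[s --> within (fun s => \val t < \val s) (nbhs t)] --> x t) /\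
  (forall t : I01 R, 0 < \val t -> exists l : S,
    x s @[s --> within (fun s => \val s < \val t) (nbhs t)] --> l).
  by exists (Cadlag xr xl).
split=> t tb; have /andP[t0 t1] := I01_bounds t.
  apply/cvg_ballP => e /osc[v [T [T0 T1 Ti]]].
  have [|i iv /andP[ti it]] := @right_cell R T v (\val t).
    by rewrite T0 T1 t0.
  apply/right_nbhsP; exists (T i.+1 - \val t); first by rewrite subr_gt0.
  move=> s /andP[ts st]; apply: (Ti _ iv); first by rewrite ti.
  by move: st; rewrite addrC subrK => ->; rewrite (le_trans ti (ltW ts)).
have FP := left_nbhs_proper tb.
have xQ : within (fun s : I01 R => \val s < \val t) (nbhs t) (x @^-1` Q).
  by apply/left_nbhsP; exists 1 => // s _; exact: Qx.
have [l [_ xl]] := Qc (fmap_proper_filter x FP) xQ.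
exists l; apply/cvg_ballP => e e0.
have e20 : 0 < e / 2 by rewrite divr_gt0.
have [v [T [T0 T1 Ti]]] := osc _ e20.
have [|i iv /andP[ti it]] := @left_cell R T v (\val t).
  by rewrite T0 T1 tb.
(* one value of x near the cluster point drags the whole cell along *)
pose U := [set s : I01 R | T i < \val s < \val t].
have FU : within (fun s : I01 R => \val s < \val t) (nbhs t) U.
  apply/left_nbhsP; exists (\val t - T i); first by rewrite subr_gt0.
  by move=> s; rewrite subKr.
have [||z [[s0 /andP[is0 s0t] <-] ls0]] := xl (x @` U) (ball l (e / 2)).
- by apply: filterS FU => s Us; exists s.
- exact: nbhsx_ballx.
apply: filterS FU => s /= /andP[is_ st].
apply: (ball_split ls0); apply: (Ti _ iv).
  by rewrite (ltW is0) (lt_le_trans s0t it).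
by rewrite (ltW is_) (lt_le_trans st it).
Qed.


Variables (F : set_system (cadlag R S)) (A : set (cadlag R S)).
Hypotheses (FU : UltraFilter F) (FA : F A).
Hypothesis AQ : forall y, A y -> forall s, Q (y s).

Let ultra_lim (T : topologicalType) (K : set T) (f : cadlag R S -> T) :
  compact K -> F (f @^-1` K) -> exists2 a, K a & f @ F --> a.
Proof.
rewrite compact_ultra => Kc FK.
by have [a [Ka fa]] := Kc _ (ultra_fmap f FU) FK; exists a.
Qed.

(** Along the ultrafilter the number of cells of near-optimal partitions is
    eventually constant, and the knots and the values at the knots converge.
    Sparsity survives in the limit: distinct knots do not merge. *)
Lemma ultra_skeleton (delta e : R) : 0 < delta ->
  (forall y, A y -> exists v T, sparse delta v T /\
     forall i, (i < v)%N -> osc_ball y e (T i) (T i.+1)) ->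
  exists v (t : nat -> R) (T : cadlag R S -> nat -> R) (z : nat -> S),
  [/\ [/\ t 0%N = 0, t v = 1 & forall i, (i < v)%N -> t i < t i.+1],
    F [set y | sparse delta v (T y) /\
       forall i, (i < v)%N -> osc_ball y e (T y i) (T y i.+1)],
    forall i, (i <= v)%N -> T y i @[y --> F] --> t i &
    forall i, (i <= v)%N -> (y : cadlag R S) (clip (T y i)) @[y --> F] --> z i].
Proof.
move=> d0 Asparse.
have : forall y : cadlag R S, exists p : nat * (nat -> R), A y -> sparse delta p.1 p.2 /\
     forall i, (i < p.1)%N -> osc_ball y e (p.2 i) (p.2 i.+1).
  move=> y; have [/Asparse[v [T vT]]|nA] := pselect (A y); first by exists (v, T).
  by exists (0%N, fun=> 0).
move=> /choice[p pP].
(* v cells longer than delta fit in [0, 1], so v is at most 1 / delta *)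
have [N NP] : exists N : nat, delta^-1 <= N%:R.
  by exists (Num.bound delta^-1); apply/ltW/archi_boundP; rewrite invr_ge0 ltW.
have FN : F [set y | ((p y).1 <= N)%N].
  apply: filterS FA => y /pP[[T0 Tv Ti Td] _] /=.
  have h i : (i <= (p y).1)%N -> i%:R * delta <= (p y).2 i.
    elim: i => [|i IHi] iv; first by rewrite mul0r T0.
    have := IHi (ltnW iv); have := Td i iv; rewrite -natr1 mulrDl mul1r; lra.
  have := h _ (leqnn _); rewrite Tv -ler_pdivlMr// mul1r => h1.
  by rewrite -(ler_nat R) (le_trans h1).
have [v Fv] := ultra_bounded_nat FU FN.
pose T y := (p y).2.
have FT : F [set y | A y /\ (sparse delta v (T y) /\
    forall i, (i < v)%N -> osc_ball y e (T y i) (T y i.+1))].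
  by apply: filterS (filterI FA Fv) => y [Ay <-]; split => //; exact: pP.
have tE i : exists t : R, (i <= v)%N -> T y i @[y --> F] --> t.
  have [iv|_] := leqP i v; last by exists 0.
  have [|t _ tT] := @ultra_lim R _ (T ^~ i) (@segment_compact _ 0 1).
    apply: filterS FT => y [_ [[T0 Tv Ti _] _]] /=; rewrite in_itv /=.
    exact: (knots01 T0 Tv Ti).
  by exists t.
have zE i : exists z : S, (y : cadlag R S) (clip (T y i)) @[y --> F] --> z.
  have [|z _ zT] := @ultra_lim S _ (fun y : cadlag R S => y (clip (T y i))) Qc.
    by apply: filterS FA => y Ay; exact: AQ.
  by exists z.
have [t tP] := choice tE; have [z zP] := choice zE.
exists v, t, T, z; split => //.
  have tlim (i : nat) c : (i <= v)%N ->
      (forall y, sparse delta v (T y) -> T y i = c) -> t i = c.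
    move=> iv Tc; apply/le_anti/andP; split.
      apply: (cvgr_to_le (tP i iv)).
      by apply: filterS FT => y [_ [/Tc -> _]].
    apply: (cvgr_to_ge (tP i iv)).
    by apply: filterS FT => y [_ [/Tc -> _]].
  split.
  - by apply: tlim => // y [].
  - by apply: tlim => // y [].
  move=> i iv; rewrite -subr_gt0; apply: (lt_le_trans d0).
  apply: (cvgr_to_ge (cvgB (tP _ iv) (tP _ (ltnW iv)))).
  by apply: filterS FT => y [_ [[_ _ _ Td] _]]; apply/ltW/Td.
by apply: filterS FT => y [].
Qed.

End UltraLimit.

(** Let X be the pointwise limit of the paths along F, and let x s be a cluster
    point of X to the right of s, since X itself is unreliable at limits of
    moving jumps.  Each skeleton pins down x: for s inside a cell the knot value
    z i is within 2e of X s, hence within 3e of x s.  So x is regulated, and a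
    path close to the skeleton is matched with x by the time change that sends
    limit knots to knots.  The cost enters only through its domination by the
    logarithmic norm, whence one proof for both distances. *)
Lemma ultra_skorokhod_cvg (R : realType) (S : pseudoMetricType R)
    (d : S -> S -> \bar R) (c : timechange R -> \bar R) (Q : set S)
    (F : set_system (cadlag R S)) (A : set (cadlag R S)) :
  (forall p q e, ball p e q <-> (d p q < e%:E)%E) ->
  (forall e, 0 < e -> exists2 k, 0 < k &
     forall l, (lognorm l <= k%:E)%E -> (c l <= e%:E)%E) ->
  compact Q -> UltraFilter F -> F A -> (forall y, A y -> forall s, Q (y s)) ->
  (forall e, 0 < e -> exists2 delta, 0 < delta &
     forall y, A y -> (cadlag_modulus d y delta < e%:E)%E) ->
  exists x : cadlag R S, forall e, 0 < e ->
    F [set y : cadlag R S | (skorokhod_dist c d x y < e%:E)%E].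
Proof.
move=> dball csmall Qc FU FA AQ Amod.
have XE (s : I01 R) : exists a, Q a /\ (y : cadlag R S) s @[y --> F] --> a.
  have FQ : F [set y : cadlag R S | Q (y s)].
    by apply: filterS FA => y Ay; exact: AQ.
  move: Qc; rewrite compact_ultra => Qu.
  by have [a] := Qu _ (ultra_fmap (fun y : cadlag R S => y s) FU) FQ; exists a.
have [X XP] := choice XE.
have xE (s : I01 R) : exists a, [/\ Q a,
    \val s < 1 -> forall e r, 0 < e -> 0 < r -> exists s' : I01 R,
      \val s < \val s' < \val s + r /\ ball (X s') e a &
    1 <= \val s -> a = X s].
  have [s1|s1] := ltP (\val s) 1; last first.
    by exists (X s); split => //; case: (XP s).
  have FP := right_nbhs_proper s1.
  have XQ : within (fun s' : I01 R => \val s < \val s') (nbhs s) (X @^-1` Q).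
    by apply/right_nbhsP; exists 1 => // s' _; case: (XP s').
  have [a [Qa Xa]] := Qc _ (fmap_proper_filter X FP) XQ.
  exists a; split => //.
  move=> _ e r e0 r0.
  have [||_ [[s' ss' <-] as']] :=
    Xa (X @` [set s' : I01 R | \val s < \val s' < \val s + r]) (ball a e).
  - by apply/right_nbhsP; exists r => // s' ss'; exists s'.
  - exact: nbhsx_ballx.
  by exists s'; split => //; exact: ball_sym.
have [x xP] := choice xE.
have skel e : 0 < e -> exists v (t : nat -> R) (T : cadlag R S -> nat -> R)
    (z : nat -> S),
  [/\ [/\ t 0%N = 0, t v = 1 & forall i, (i < v)%N -> t i < t i.+1],
    exists delta, F [set y | sparse delta v (T y) /\
       forall i, (i < v)%N -> osc_ball y e (T y i) (T y i.+1)],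
    forall i, (i <= v)%N -> T y i @[y --> F] --> t i,
    forall i, (i <= v)%N -> (y : cadlag R S) (clip (T y i)) @[y --> F] --> z i &
    forall i s, (i < v)%N -> t i <= \val s < t i.+1 -> ball (z i) (3 * e) (x s)].
  move=> e0; have [delta d0 dA] := Amod e e0.
  have [|v [t [T [z [[t0 tv ti] FT tT zT]]]]] :=
    ultra_skeleton (e := e) Qc FU FA AQ d0.
    by move=> y Ay; apply: (modulus_lt dball); exact: dA.
  exists v, t, T, z; split => //; first by exists delta.
  have e20 : 0 < e / 2 by rewrite divr_gt0.
  have zX i s : (i < v)%N -> t i < \val s < t i.+1 -> ball (z i) (2 * e) (X s).
    move=> iv /andP[si1 si2].
    have F1 : F [set w | T w i < \val s].
      exact: (cvgr_lt _ (tT i (ltnW iv)) _ si1).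
    have F2 : F [set w | \val s < T w i.+1].
      exact: (cvgr_gt _ (tT i.+1 iv) _ si2).
    have F3 : F [set w : cadlag R S | ball (z i) (e / 2) (w (clip (T w i)))].
      exact: (zT i (ltnW iv)) (nbhsx_ballx _ _ e20).
    have F4 : F [set w : cadlag R S | ball (X s) (e / 2) (w s)].
      exact: (XP s).2 (nbhsx_ballx _ _ e20).
    have [y [[[[yT osc] [/= h1 h2]] /= h3] /= h4]] :=
      filter_ex (filterI (filterI (filterI FT (filterI F1 F2)) F3) F4).
    have -> : 2 * e = e / 2 + e + e / 2 by field.
    apply: (ball_triangle _ (ball_sym h4)); apply: (ball_triangle h3).
    have [T0 Tv Ti Td] := yT.
    have Tb := knots01 T0 Tv Ti (ltnW iv).
    by apply: (osc i iv); rewrite ?(clipE Tb) ?lexx ?Ti// (ltW h1).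
  move=> i s iv /andP[si1 si2]; have [_ xs _] := xP s.
  have s1 : \val s < 1.
    by apply: lt_le_trans si2 _; rewrite -tv; apply: (knots_le ti); rewrite iv /=.
  have r0 : 0 < t i.+1 - \val s by rewrite subr_gt0.
  have [s' [/andP[ss' s's] Xx]] := xs s1 e (t i.+1 - \val s) e0 r0.
  have -> : 3 * e = 2 * e + e by ring.
  apply: ball_triangle Xx; apply: zX => //.
  by rewrite (le_lt_trans si1 ss') /=; move: s's; rewrite addrC subrK.
have [y yx] : exists y : cadlag R S, y =1 x.
  apply: (regulated_cadlag Qc) => [s|e e0]; first by case: (xP s).
  have e60 : 0 < e / 6 by rewrite divr_gt0.
  have [v [t [T [z [[t0 tv ti] _ _ _ zx]]]]] := skel _ e60.
  exists v, t; split => // i iv s1 s2 s1i s2i.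
  have -> : e = 3 * (e / 6) + 3 * (e / 6) by field.
  exact: ball_triangle (ball_sym (zx i s1 iv s1i)) (zx i s2 iv s2i).
exists y => e e0.
have e20 : 0 < e / 2 by rewrite divr_gt0.
have [k k0 kc] := csmall _ e20.
(* the three errors met below are 3h, h and h, in all e / 2 *)
pose h := e / 10; have h0 : 0 < h by rewrite divr_gt0.
have [v [t [T [z [[t0 tv ti] [delta FT] tT zT zx]]]]] := skel _ h0.
have Fslope : F [set w | forall i, (i < v)%N ->
    expR (- k) <= (T w i.+1 - T w i) / (t i.+1 - t i) <= expR k].
  apply: filter_forall_lt => i iv.
  have tt0 : 0 < t i.+1 - t i by rewrite subr_gt0 ti.
  have cv : (T w i.+1 - T w i) / (t i.+1 - t i) @[w --> F] --> (1 : R).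
    rewrite -(divff (x := t i.+1 - t i)) ?gt_eqF//.
    by apply: cvgM; [exact: cvgB (tT _ iv) (tT _ (ltnW iv))|exact: cvg_cst].
  have kN : expR (- k) < 1 by rewrite expR_lt1 oppr_lt0.
  have kP : 1 < expR k by rewrite expR_gt1.
  have FN : F [set w | expR (- k) < (T w i.+1 - T w i) / (t i.+1 - t i)].
    exact: (cvgr_gt _ cv _ kN).
  have FK : F [set w | (T w i.+1 - T w i) / (t i.+1 - t i) < expR k].
    exact: (cvgr_lt _ cv _ kP).
  by apply: filterS (filterI FN FK) => w [/ltW /= -> /ltW ->].
have Fz : F [set w : cadlag R S | forall i, (i < v)%N -> ball (z i) h (w (clip (T w i)))].
  apply: filter_forall_lt => i iv.
  by apply: zT (nbhsx_ballx _ _ h0); exact: ltnW.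
have F1 : F [set w : cadlag R S | ball (X (clip 1)) h (w (clip 1))].
  exact: (XP (clip 1)).2 (nbhsx_ballx _ _ h0).
apply: filterS (filterI (filterI FT F1) (filterI Fslope Fz)) => w.
case=> [[[wT osc] w1] [wslope wz]]; have [T0 Tv Ti Td] := wT.
have [l [lk lT]] := piecewise_timechange t0 tv T0 Tv ti wslope.
apply: (@le_lt_trans _ _ (e / 2)%:E); last by rewrite lte_fin; lra.
apply: (skor_le dball (l := l)); first exact: kc.
move=> s; rewrite yx; have /andP[s0 s1] := I01_bounds s.
have h5 : e / 2 = 3 * h + h + h by rewrite /h; field.
rewrite h5; have [sl1|sg1] := ltP (\val s) 1; last first.
  have s1E : \val s = 1 by apply/le_anti; rewrite s1.
  have sE : s = clip 1 by apply: val_inj; rewrite clipE// ler01 lexx.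
  have [_ _ ->] := xP s => //.
  have -> : l s = clip 1.
    by apply: val_inj; rewrite (timechange1 l s1E) clipE// ler01 lexx.
  by rewrite sE; apply: le_ball w1; lra.
have [|i iv /andP[si1 si2]] := @right_cell R t v (\val s).
  by rewrite t0 tv s0.
have tb j : (j <= v)%N -> \val (clip (t j)) = t j.
  by move=> jv; apply/clipE/(knots01 t0 tv ti).
have Tb j : (j <= v)%N -> \val (clip (T w j)) = T w j.
  by move=> jv; apply/clipE/(knots01 T0 Tv Ti).
apply: (@ball_triangle _ _ (w (clip (T w i)))).
  apply: (@ball_triangle _ _ (z i)); last exact: wz.
  by apply/ball_sym/zx => //; rewrite si1.
apply: (osc i iv); first by rewrite (Tb _ (ltnW iv)) lexx Ti.
rewrite -(lT i _ (ltnW iv) (tb i (ltnW iv))) -(lT i.+1 _ iv (tb i.+1 iv)).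
rewrite timechange_le ?timechange_incr//.
  by rewrite (tb _ iv).
by rewrite (tb _ (ltnW iv)).
Qed.

(** * Locally uniform properties of cadlag paths *)

(** The supremum of the points that good cells reach from 0 is itself reached,
    by the left hypothesis, and cannot be below 1, by the right one. *)
Lemma sparse_partition (R : realType) (G : R -> R -> Prop) :
  (forall t, 0 < t <= 1 -> exists2 r, 0 < r & forall a, t - r < a < t -> G a t) ->
  (forall t, 0 <= t < 1 -> exists2 r, 0 < r & forall b, t < b < t + r -> G t b) ->
  exists delta v T, [/\ 0 < delta, sparse delta v T &
    forall i, (i < v)%N -> G (T i) (T i.+1)].
Proof.
move=> Gl Gr.
pose good t := exists delta v T, [/\ 0 < delta, T 0%N = 0, T v = t &
  forall i, (i < v)%N -> delta < T i.+1 - T i /\ G (T i) (T i.+1)].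
have good0 : good 0 by exists 1, 0%N, (fun=> 0).
have goodS t t' : good t -> t < t' -> G t t' -> good t'.
  move=> [delta [v [T [d0 T0 Tv Ti]]]] tt' Gtt'.
  exists (Num.min delta ((t' - t) / 2)), v.+1,
    (fun i => if (i <= v)%N then T i else t').
  have d'0 : 0 < (t' - t) / 2 by rewrite divr_gt0 ?subr_gt0.
  split => //; [by rewrite lt_min d0|by rewrite ltnn|].
  move=> i; rewrite ltnS => iv'; rewrite iv'.
  move: iv'; rewrite leq_eqVlt => /orP[/eqP ->|iv].
    rewrite ltnn Tv; split => //.
    by rewrite gt_min; apply/orP; right; lra.
  rewrite iv; have [h1 h2] := Ti i iv; split => //.
  by rewrite gt_min h1.
pose E := [set t : R | 0 <= t <= 1 /\ good t].
have E0 : E 0 by split => //; rewrite lexx ler01.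
have supE : has_sup E.
  by split; [exists 0|exists 1 => t [/andP[]]].
pose c := sup E.
have c0 : 0 <= c by apply: ub_le_sup => //; case: supE.
have c1 : c <= 1 by apply: ge_sup; [exists 0|move=> t [/andP[]]].
have goodc : good c.
  move: c0; rewrite le_eqVlt => /orP[/eqP <-//|c0].
  have [|r r0 rG] := Gl c; first by rewrite c0.
  have [a [a01 ga] ca] := sup_adherent r0 supE.
  have ac : a <= c by apply: ub_le_sup => //; case: supE.
  move: ac; rewrite le_eqVlt => /orP[/eqP <-//|ac].
  by apply: (goodS a) => //; apply: rG; rewrite ca.
have c1E : c = 1.
  apply/le_anti; rewrite c1 leNgt; apply/negP => c1'.
  have [|r r0 rG] := Gr c; first by rewrite c0.
  have [b bP] : exists b, b = c + Num.min (r / 2) (1 - c) by eexists.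
  have m0 : 0 < Num.min (r / 2) (1 - c) by rewrite lt_min divr_gt0// subr_gt0.
  have m1 : Num.min (r / 2) (1 - c) <= r / 2 by rewrite ge_min lexx.
  have m2 : Num.min (r / 2) (1 - c) <= 1 - c by rewrite ge_min lexx orbT.
  have cb : c < b by lra.
  have br : b < c + r by lra.
  have Eb : E b.
    split; first by apply/andP; split; lra.
    by apply: (goodS c) => //; apply: rG; rewrite cb.
  have : b <= c by apply: ub_le_sup => //; case: supE.
  by rewrite leNgt cb.
move: goodc; rewrite c1E => -[delta [v [T [d0 T0 Tv Ti]]]].
exists delta, v, T; split => //; last by move=> i /Ti[].
split=> // i /Ti[Td _] //.
by rewrite -subr_gt0 (lt_trans d0).
Qed.

(** One radius bounds both the neighbourhood and the parameter.  Unlike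
    pointwise validity for small delta, this property passes from the values of
    a path to the path and becomes uniform on compact sets. *)
Definition locally_uniform (R : realType) (S : Type) (d : S -> S -> \bar R)
    (P : R -> S -> Prop) :=
  forall z, exists2 rho, 0 < rho &
    forall z' delta, (d z z' < rho%:E)%E -> 0 < delta < rho -> P delta z'.

Lemma locally_uniform_compact (R : realType) (S : pseudoMetricType R)
    (d : S -> S -> \bar R) (P : R -> S -> Prop) (K : set S) :
  (forall p q e, ball p e q <-> (d p q < e%:E)%E) ->
  locally_uniform d P -> compact K ->
  exists2 rho, 0 < rho &
    forall x delta, K x -> 0 < delta < rho -> P delta x.
Proof.
move=> dball Plu /compact_near_coveringP/(_ R 0^'+ P _) KP.
have : \forall delta \near (0 : R)^'+, K `<=` P delta.
  apply: KP => z _; have [rho rho0 rhoP] := Plu z.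
  exists (ball z rho, [set delta : R | 0 < delta < rho]) => /=.
    split; first exact: nbhsx_ballx.
    near=> r; apply/andP; split; near: r.
      exact: nbhs_right_gt.
    exact: nbhs_right_lt.
  by move=> [z' delta] /= [zz' dr]; apply: rhoP => //; exact/dball.
rewrite near_withinE => /nbhs_ballP[rho rho0 rhoP]; exists rho => // x delta Kx.
move=> /andP[d0 dr]; apply: rhoP => //.
by rewrite -ball_normE /= sub0r normrN gtr0_norm.
Unshelve. all: by end_near. Qed.

Section SkorokhodNecessity.
Variables (R : realType) (S : pseudoMetricType R).
Variables (d : S -> S -> \bar R) (c : timechange R -> \bar R).
Hypothesis dball : forall p q e, ball p e q <-> (d p q < e%:E)%E.

Lemma cadlag_right_ball (x : cadlag R S) (t : I01 R) e : \val t < 1 -> 0 < e ->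
  exists2 r, 0 < r &
    forall s, \val t <= \val s < \val t + r -> ball (x t) e (x s).
Proof.
move=> t1 e0; have := @cadlag_right R S x t t1 _ (nbhsx_ballx (x t) e e0).
move=> /right_nbhsP[r r0 rP]; exists r => // s /andP[].
rewrite le_eqVlt => /orP[/eqP/val_inj <- _|ts st]; first exact: ballxx.
by apply: rP; rewrite ts.
Qed.

Lemma cadlag_left_ball (x : cadlag R S) (t : I01 R) : 0 < \val t ->
  exists l, forall e, 0 < e ->
  exists2 r, 0 < r & forall s, \val t - r < \val s < \val t -> ball l e (x s).
Proof.
move=> t0; have [l xl] := @cadlag_left R S x t t0.
exists l => e e0.
by have /left_nbhsP[r r0 rP] := xl _ (nbhsx_ballx l e e0); exists r.
Qed.

Lemma cadlag_sparse (x : cadlag R S) e : 0 < e ->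
  exists delta v T, [/\ 0 < delta, sparse delta v T &
    forall i, (i < v)%N -> osc_ball x e (T i) (T i.+1)].
Proof.
move=> e0; have e20 : 0 < e / 2 by rewrite divr_gt0.
apply: sparse_partition => t /andP[t0 t1].
  have tE : \val (clip t) = t by rewrite clipE// (ltW t0).
  have [|l lP] := @cadlag_left_ball x (clip t); first by rewrite tE.
  have [r r0 rP] := lP _ e20; rewrite tE in rP.
  exists r => // a /andP[ra at_] s1 s2 /andP[s1a s1t] /andP[s2a s2t].
  apply: (ball_splitr (z := l)); apply: rP.
    by rewrite s1t (lt_le_trans ra).
  by rewrite s2t (lt_le_trans ra).
have tE : \val (clip t) = t by rewrite clipE// t0 ltW.
have [||r r0 rP] := @cadlag_right_ball x (clip t) (e / 2) => //; first by rewrite tE.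
rewrite tE in rP.
exists r => // b /andP[tb br] s1 s2 /andP[s1t s1b] /andP[s2t s2b].
apply: (ball_splitr (z := x (clip t))); apply: rP.
  by rewrite s1t (lt_trans s1b).
by rewrite s2t (lt_trans s2b).
Qed.

(** Moving the knots of a good partition of x by the time change gives a good
    partition for y; a displacement below a quarter of the mesh keeps at least
    half of the sparsity. *)
Lemma modulus_timechange (x y : I01 R -> S) (l : timechange R) delta v T e r :
  0 < delta -> 0 <= e -> 0 <= r -> sparse delta v T ->
  (forall i, (i < v)%N -> osc_ball x e (T i) (T i.+1)) ->
  (unifnorm l <= (delta / 4)%:E)%E -> (forall t, ball (x t) r (y (l t))) ->
  (cadlag_modulus d y (delta / 2) <= (r + e + r)%:E)%E.
Proof.
move=> d0 e0 r0 [T0 Tv Ti Td] osc lu xy.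
have Tb j : (j <= v)%N -> \val (clip (T j)) = T j.
  by move=> jv; apply/clipE/(knots01 T0 Tv Ti).
have disp t : `|\val (l t) - \val t| <= delta / 4.
  by rewrite -lee_fin; apply: le_trans lu; apply: ereal_sup_ubound; exists t.
pose T' i := \val (l (clip (T i))).
have gap i : (i < v)%N -> delta / 2 < T' i.+1 - T' i.
  move=> iv; have := disp (clip (T i)); have := disp (clip (T i.+1)).
  rewrite !ler_distl -/(T' i) -/(T' i.+1) (Tb _ iv) (Tb _ (ltnW iv)).
  by have := Td i iv; move=> ? /andP[? ?] /andP[? ?]; lra.
apply: (modulus_le dball (v := v) (T := T')).
- by rewrite !addr_ge0.
- split => //.
  + by rewrite /T' timechange0// Tb.
  + by rewrite /T' timechange1// Tb.
  + by move=> i iv; rewrite -subr_gt0 (lt_trans _ (gap i iv)) ?divr_gt0.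
move=> i iv s1 s2; rewrite -(Defs.invfK l s1) -(Defs.invfK l s2).
move: (Defs.invf l s1) (Defs.invf l s2) => u1 u2 /andP[h1 h2] /andP[h3 h4].
apply: ball_triangle (xy u2); apply: (ball_triangle (ball_sym (xy u1))).
apply: (osc i iv).
  rewrite -(Tb _ iv) -(Tb _ (ltnW iv)).
  by rewrite (timechange_le_inv h1) (timechange_lt_inv h2).
rewrite -(Tb _ iv) -(Tb _ (ltnW iv)).
by rewrite (timechange_le_inv h3) (timechange_lt_inv h4).
Qed.

(** The modulus is not continuous in the path, but it is upper semicontinuous
    up to halving delta. *)
Lemma modulus_locally_uniform e : 0 < e ->
  (forall u, 0 < u -> exists2 k, 0 < k &
     forall l, (c l <= k%:E)%E -> (unifnorm l <= u%:E)%E) ->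
  locally_uniform (fun x y : cadlag R S => skorokhod_dist c d x y)
    (fun delta x => (cadlag_modulus d x delta <= e%:E)%E).
Proof.
move=> e0 cunif x; have e40 : 0 < e / 4 by rewrite divr_gt0.
have [delta [v [T [d0 Ts osc]]]] := cadlag_sparse x e40.
have [|k k0 kc] := cunif (delta / 4); first by rewrite divr_gt0.
exists (Num.min (Num.min k (e / 4)) (delta / 2)).
  by rewrite !lt_min k0 e40 divr_gt0.
move=> y delta' /(skor_lt dball)[l [cl xy]] /andP[d'0].
rewrite !lt_min => /andP[_ d'd].
apply: le_trans (modulus_mono _ _ (ltW d'd)) _.
apply: le_trans (modulus_timechange (y := y) (l := l) (r := e / 4) d0
  (ltW e40) (ltW e40) Ts osc _ _) _.
- apply: kc; apply: le_trans (ltW cl) _.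
  by rewrite lee_fin !ge_min lexx.
- by move=> t; apply: le_ball (xy t); rewrite !ge_min lexx orbT.
- by rewrite lee_fin; lra.
Qed.

Lemma uniform_below (Pr : nat -> R -> Prop) v :
  (forall i r r', Pr i r -> r' <= r -> Pr i r') ->
  (forall i, (i < v)%N -> exists2 r, 0 < r & Pr i r) ->
  exists2 r, 0 < r & forall i, (i < v)%N -> Pr i r.
Proof.
move=> mono; elim: v => [|v IHv] H; first by exists 1.
have [r r0 rP] := IHv (fun i iv => H i (ltnW iv)).
have [r' r'0 r'P] := H v (ltnSn v).
exists (Num.min r r'); first by rewrite lt_min r0.
move=> i; rewrite ltnS leq_eqVlt => /orP[/eqP ->|/rP iP].
  by apply: mono r'P _; rewrite ge_min lexx orbT.
by apply: mono iP _; rewrite ge_min lexx.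
Qed.

(** The range of a cadlag path together with its left limits is compact; the
    proof covers it by the cells of a partition on each of which one left limit
    or one value supplies the radius.  The endpoint 1 lies in no cell. *)
Lemma range_locally_uniform (P : R -> S -> Prop) : locally_uniform d P ->
  locally_uniform (fun x y : cadlag R S => skorokhod_dist c d x y)
    (fun delta x => forall t, P delta (x t)).
Proof.
move=> Plu x.
pose Pr a b rho := forall s z delta, a <= \val s < b -> ball (x s) rho z ->
  0 < delta < rho -> P delta z.
have Pball z : exists2 rho, 0 < rho &
    forall y z' delta, ball z rho y -> ball y rho z' -> 0 < delta < rho ->
    P delta z'.
  have [rho rho0 rhoP] := Plu z; exists (rho / 2); first by rewrite divr_gt0.
  move=> y z' delta zy yz' /andP[h1 h2]; apply: rhoP.
    by apply/dball; exact: ball_split zy yz'.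
  by rewrite h1 (lt_trans h2)// ltr_pdivrMr// mulr_natr mulr2n ltrDl.
have [||delta [v [T [d0 [T0 Tv Ti _] TP]]]] :=
    @sparse_partition R (fun a b => exists2 rho, 0 < rho & Pr a b rho).
- move=> t /andP[t0 t1].
  have tE : \val (clip t) = t by rewrite clipE// (ltW t0).
  have [|l lP] := @cadlag_left_ball x (clip t); first by rewrite tE.
  have [rho rho0 rhoP] := Pball l.
  have [r r0 rP] := lP _ rho0; rewrite tE in rP.
  exists r => // a /andP[ra at_]; exists rho => // s z dl /andP[sa st].
  by apply: rhoP; apply: rP; rewrite st (lt_le_trans ra).
- move=> t /andP[t0 t1].
  have tE : \val (clip t) = t by rewrite clipE// t0 ltW.
  have [rho rho0 rhoP] := Pball (x (clip t)).
  have [||r r0 rP] := @cadlag_right_ball x (clip t) rho => //; first by rewrite tE.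
  rewrite tE in rP.
  exists r => // b /andP[tb br]; exists rho => // s z dl /andP[ts sb].
  by apply: rhoP; apply: rP; rewrite ts (lt_trans sb).
have [|rho rho0 rhoP] := @uniform_below (fun i => Pr (T i) (T i.+1)) v _ TP.
  move=> i r r' rP r'r s z dl si xz /andP[h1 h2]; apply: (rP s) => //.
    exact: le_ball xz.
  by rewrite h1 (lt_le_trans h2).
have [rho1 rho10 rho1P] := Pball (x (clip 1)).
exists (Num.min rho rho1); first by rewrite lt_min rho0.
move=> y dl /(skor_lt dball)[l [_ xy]] /andP[dl0].
rewrite lt_min => /andP[dl1 dl2] u.
rewrite -(Defs.invfK l u); move: (Defs.invf l u) => s.
have /andP[s0 s1] := I01_bounds s.
have [sl1|sg1] := ltP (\val s) 1.
  have [|i iv si] := @right_cell R T v (\val s); first by rewrite T0 Tv s0.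
  apply: (rhoP i iv s) => //; last by rewrite dl0.
  by apply: le_ball (xy s); rewrite ge_min lexx.
have sE : s = clip 1.
  by apply: val_inj; rewrite clipE ?ler01 ?lexx//; apply/le_anti; rewrite s1.
apply: (rho1P (x s)); last by rewrite dl0.
  by rewrite sE; exact: ballxx.
by apply: le_ball (xy s); rewrite ge_min lexx orbT.
Qed.

End SkorokhodNecessity.

(** * The compactness criterion *)

Lemma sup_over_cvg0 (R : realType) (T : Type) (A : set T)
    (f : T -> R -> \bar R) :
  sup_over A (f ^~ delta) @[delta --> (0 : R)^'+] --> 0%E <->
  forall e, 0 < e -> exists2 rho, 0 < rho &
    forall x delta, A x -> 0 < delta < rho -> (f x delta <= e%:E)%E.
Proof.
split=> [f0 e e0|H U U0].
  have h : nbhs (0 : R) [set r | (r%:E < e%:E)%E].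
    apply/nbhs_ballP; exists e => // r; rewrite -ball_normE /= sub0r normrN.
    by rewrite lte_fin => /(le_lt_trans (ler_norm _)).
  have /nbhs_ballP[rho rho0 rhoP] : nbhs (0 : R) [set delta | 0 < delta ->
    (sup_over A (f ^~ delta) < e%:E)%E] := f0 [set y | (y < e%:E)%E] h.
  exists rho => // x delta Ax /andP[d0 dr].
  have : (sup_over A (f ^~ delta) < e%:E)%E.
    by apply: rhoP => //; rewrite -ball_normE /= sub0r normrN gtr0_norm.
  move=> /ltW; apply: le_trans; apply: ereal_sup_ubound; right; by exists x.
have /nbhs_ballP[e e0 eU] : nbhs (0 : R) (fun r => U r%:E) by [].
have [|rho rho0 rhoP] := H (e / 2); first by rewrite divr_gt0.
suff : nbhs (0 : R) [set delta | 0 < delta -> U (sup_over A (f ^~ delta))] by [].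
apply/nbhs_ballP; exists rho => // delta.
rewrite -ball_normE /= sub0r normrN => dr d0; rewrite (gtr0_norm d0) in dr.
have s0 : (0 <= sup_over A (f ^~ delta))%E by apply: ereal_sup_ubound; left.
have s1 : (sup_over A (f ^~ delta) <= (e / 2)%:E)%E.
  apply: ge_ereal_sup => _ [->|[x Ax <-]].
    by rewrite lee_fin divr_ge0 // ltW.
  by apply: rhoP => //; rewrite d0.
have sf : sup_over A (f ^~ delta) \is a fin_num.
  by rewrite ge0_fin_numE// (le_lt_trans s1)// ltry.
move: s0 s1; rewrite -(fineK sf) !lee_fin => s0 s1; apply: eU.
rewrite -ball_normE /= sub0r normrN ger0_norm//; apply: le_lt_trans s1 _.
by rewrite ltr_pdivrMr// mulr_natr mulr2n ltrDl.
Qed.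

Lemma ball_absdist (R : realType) (p q e : R) :
  ball p e q <-> (`|p - q|%:E < e%:E)%E.
Proof. by rewrite -ball_normE /= lte_fin. Qed.

Lemma ball_dJ1 (R : realType) (x y : skorD R) e :
  ball x e y <-> (dJ1 x y < e%:E)%E.
Proof. by []. Qed.

Lemma ball_dDD (R : realType) (x y : skorDD R) e :
  ball x e y <-> (dDD x y < e%:E)%E.
Proof. by []. Qed.

(** Boundedness written as a property indexed by small delta, so that it is
    transported to paths and to paths of paths like the moduli. *)
Lemma abs_locally_uniform (R : realType) :
  locally_uniform (fun a b : R => `|a - b|%:E)
    (fun delta a => `|a| <= delta^-1).
Proof.
move=> a; have a1 : 0 < `|a| + 1 by rewrite ltr_wpDl.
exists (Num.min 1 (`|a| + 1)^-1); first by rewrite lt_min ltr01 invr_gt0.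
move=> b delta; rewrite lte_fin lt_min => /andP[ab _] /andP[d0].
rewrite lt_min => /andP[_ da].
apply: (@le_trans _ _ (`|a| + 1)); last first.
  by rewrite -[leLHS]invrK lef_pV2 ?posrE ?invr_gt0// ltW.
have -> : b = a - (a - b) by rewrite subKr.
by apply: le_trans (ler_normB _ _) _; rewrite lerD2l ltW.
Qed.

(** The sufficiency half of the classical criterion for real paths, which
    provides the compact set of values required one level up. *)
Lemma skorD_compact (R : realType) (K : set (skorD R)) (M : R) :
  (forall x, K x -> forall s, `|x s| <= M) ->
  (forall e, 0 < e -> exists2 delta, 0 < delta &
     forall x, K x -> (w' x delta < e%:E)%E) ->
  compact (closure K).
Proof.
move=> KM Kw; apply: ultra_compact_closure => F FU FK.
have [||x xF] := @ultra_skorokhod_cvg R R _ (@lognorm R) `[- M, M]%classic F K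
  (@ball_absdist R) _ (@segment_compact _ _ _) FU FK _ Kw.
- by move=> e e0; exists e.
- by move=> x Kx s; rewrite /= in_itv /= -ler_norml; exact: KM.
by exists x; apply/fcvg_ballP => e e0; exact: xF.
Qed.

Lemma skorDD_compact (R : realType) (K : set (skorDD R)) (Q : set (skorD R)) :
  compact Q -> (forall x, K x -> forall t, Q (x t)) ->
  (forall e, 0 < e -> exists2 delta, 0 < delta &
     forall x, K x -> (wDD' x delta < e%:E)%E) ->
  compact (closure K).
Proof.
move=> Qc KQ Kw; apply: ultra_compact_closure => F FU FK.
have [x xF] := @ultra_skorokhod_cvg R (skorD R) _ (@unifnorm R) Q F K
  (@ball_dJ1 R) (@lognorm_dominates R) Qc FU FK KQ Kw.
by exists x; apply/fcvg_ballP => e e0; exact: xF.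
Qed.

Theorem theorem2p8 (R : realType) (A : set (skorDD R)) :
  compact (closure A) <->
  [/\ (sup_over A (@normDD R) < +oo)%E,
      sup_over A (fun x => ereal_sup (range (fun t => w' (x t) delta)))
        @[delta --> (0 : R)^'+] --> 0%E &
      sup_over A (fun x => wDD' x delta) @[delta --> (0 : R)^'+] --> 0%E].
Proof.
split=> [Ac|[]].
  have Asub := @subset_closure _ A.
  split.
  - have lu1 := range_locally_uniform (@lognorm R) (@ball_absdist R)
      (@abs_locally_uniform R).
    have lu2 := range_locally_uniform (S := skorD R) (@unifnorm R)
      (@ball_dJ1 R) lu1.
    have [rho rho0 rhoP] := locally_uniform_compact (@ball_dDD R) lu2 Ac.
    apply: (@le_lt_trans _ _ ((rho / 2)^-1)%:E); last exact: ltry.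
    apply: ge_ereal_sup => _ [->|[x Ax <-]].
      by rewrite lee_fin invr_ge0 divr_ge0// ltW.
    apply: ge_ereal_sup => _ [t _ <-]; apply: ge_ereal_sup => _ [s _ <-].
    rewrite lee_fin; apply: (rhoP x (rho / 2) (Asub x Ax)).
    by rewrite divr_gt0//= ltr_pdivrMr// mulr_natr mulr2n ltrDl.
  - apply: (sup_over_cvg0 A (fun x delta =>
      ereal_sup (range (fun t => w' (x t) delta)))).2 => e e0.
    have lu1 := modulus_locally_uniform (@ball_absdist R) e0
      (@lognorm_dominates R).
    have lu2 := range_locally_uniform (S := skorD R) (@unifnorm R)
      (@ball_dJ1 R) lu1.
    have [rho rho0 rhoP] := locally_uniform_compact (@ball_dDD R) lu2 Ac.
    exists rho => // x delta Ax dr; apply: ge_ereal_sup => _ [t _ <-].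
    by apply: rhoP => //; exact: Asub.
  - apply: (sup_over_cvg0 A (@wDD' R)).2 => e e0.
    have uu u : 0 < u -> exists2 k, 0 < k & forall l : timechange R,
        (unifnorm l <= k%:E)%E -> (unifnorm l <= u%:E)%E by exists u.
    have lu := modulus_locally_uniform (S := skorD R) (@ball_dJ1 R) e0 uu.
    have [rho rho0 rhoP] := locally_uniform_compact (@ball_dDD R) lu Ac.
    by exists rho => // x delta Ax dr; apply: rhoP => //; exact: Asub.
move=> Abd Aw0 AwDD0.
have Aw := (sup_over_cvg0 A (fun x delta =>
  ereal_sup (range (fun t => w' (x t) delta)))).1 Aw0.
have AwDD := (sup_over_cvg0 A (@wDD' R)).1 AwDD0.
have half (rho : R) : 0 < rho -> 0 < rho / 2 < rho.
  by move=> r0; rewrite divr_gt0//= ltr_pdivrMr// mulr_natr mulr2n ltrDl.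
have strict (e : R) : 0 < e -> ((e / 2)%:E < e%:E)%E.
  by move=> /half/andP[_]; rewrite lte_fin.
(* boundedness and the inner modulus make this set relatively compact *)
pose K := [set z : skorD R | exists x t, A x /\ z = x t].
have s0 : (0 <= sup_over A (@normDD R))%E by apply: ereal_sup_ubound; left.
have sf : sup_over A (@normDD R) \is a fin_num by rewrite ge0_fin_numE.
apply: (@skorDD_compact R A (closure K)).
- apply: (@skorD_compact R K (fine (sup_over A (@normDD R)))) => [z|e e0].
    move=> [x [t [Ax ->]]] s; rewrite -lee_fin fineK//.
    apply: (@le_trans _ _ (normDD x)); last first.
      by apply: ereal_sup_ubound; right; exists x.
    apply: (@le_trans _ _ (ereal_sup (range (fun s => `|x t s|%:E)))).
      by apply: ereal_sup_ubound; exists s.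
    by apply: ereal_sup_ubound; exists t.
  have [|rho rho0 rhoP] := Aw (e / 2); first by rewrite divr_gt0.
  exists (rho / 2); first by rewrite divr_gt0.
  move=> z [x [t [Ax ->]]]; apply: le_lt_trans (strict e e0).
  apply: le_trans (rhoP x (rho / 2) Ax (half _ rho0)).
  by apply: ereal_sup_ubound; exists t.
- by move=> x Ax t; apply: subset_closure; exists x, t.
move=> e e0; have [|rho rho0 rhoP] := AwDD (e / 2); first by rewrite divr_gt0.
exists (rho / 2); first by rewrite divr_gt0.
move=> x Ax; apply: le_lt_trans (strict e e0).
exact: rhoP x (rho / 2) Ax (half _ rho0).
Qed.
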